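(* Let $G$ be a finite group. Then: (1) $\mathrm{girth}(\mathcal I(G))\in\{3,6,\infty\}$; (2) $\mathcal I(G)$ is $K_{1,3}$-free if and only if, for some distinct primes $p,q,r$, $G$ is isomorphic to one of $\mathbb Z_{p^\alpha}$ ($\alpha=2,3,4$), $\mathbb Z_{p^\alpha q}$ ($\alpha=1,2$), $\mathbb Z_{pqr}$, $\mathbb Z_p\times\mathbb Z_p$ or $\mathbb Z_q\rtimes\mathbb Z_p$.
   Context: For a finite group $G$, the inclusion graph of subgroups $\mathcal I(G)$ is the simple graph whose vertices are the proper subgroups of $G$, where ''proper'' means different from both the trivial subgroup and $G$ itself; two distinct vertices $H,K$ are adjacent if and only if $H\subset K$ or $K\subset H$. Graphs are understood to have a nonempty vertex set, so $G$ is assumed to have at least one subgroup different from $\{e\}$ and $G$. The girth of a graph is the length of a shortest cycle, and $\infty$ if there is no cycle. A graph is $X$-free if it has no subgraph (not necessarily induced) isomorphic to $X$. $K_{1,3}$ is the star with three edges (claw). $\mathbb Z_q\rtimes\mathbb Z_p$ denotes the non-abelian semidirect product $\langle a,b\mid a^q=b^p=1,\ bab^{-1}=a^i,\ \mathrm{ord}_q(i)=p\rangle$, where $p\mid(q-1)$ and $\mathrm{ord}_q(i)$ is the multiplicative order of $i$ modulo $q$. *)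

(* Defs.v *)
From mathcomp Require Import all_boot all_algebra.
From mathcomp Require Import all_fingroup all_solvable.

Set Implicit Arguments.
Unset Strict Implicit.
Unset Printing Implicit Defensive.

Section Graph.

(* A finite simple graph is a symmetric irreflexive relation on a finType. *)

Definition has_cycle_of_length (V : finType) (e : rel V) (k : nat) : bool :=
  (2 < k) && [exists c : k.-tuple V, ucycleb e c].

(* None stands for infinite girth.  The search range is exhaustive because the
   vertices of a cycle are pairwise distinct; see girth_Some and girth_None. *)
Definition girth (V : finType) (e : rel V) : option nat :=
  ohead [seq k <- iota 0 #|V|.+1 | has_cycle_of_length e k].

(* The subgraph is not required to be induced: edges are preserved, but not
   necessarily reflected, by f. *)
Definition contains_subgraph (W V : finType) (x : rel W) (e : rel V) : Prop :=
  exists2 f : W -> V, injective f & {homo f : u v / x u v >-> e u v}.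

Definition subgraph_free (W V : finType) (x : rel W) (e : rel V) : Prop :=
  ~ contains_subgraph x e.

Definition complete_bipartite (m n : nat) : rel ('I_m + 'I_n) :=
  fun u v => match u, v with
             | inl _, inr _ | inr _, inl _ => true
             | _, _ => false
             end.

Lemma has_cycle_le_card (V : finType) (e : rel V) (k : nat) :
  has_cycle_of_length e k -> k <= #|V|.
Proof.
case/andP=> _ /existsP[c /andP[_ uc]].
by rewrite -(size_tuple c) -(card_uniqP uc) max_card.
Qed.

Lemma girth_Some (V : finType) (e : rel V) (k : nat) :
  girth e = Some k <->
  has_cycle_of_length e k /\ forall l, has_cycle_of_length e l -> k <= l.
Proof.
have mem l : (l \in [seq j <- iota 0 #|V|.+1 | has_cycle_of_length e j])
             = has_cycle_of_length e l.
  rewrite mem_filter mem_iota add0n ltnS /=.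
  by apply/andb_idr; apply: has_cycle_le_card.
have : sorted leq [seq j <- iota 0 #|V|.+1 | has_cycle_of_length e j].
  by apply: sorted_filter (iota_sorted _ _); apply: leq_trans.
rewrite /girth; case: filter mem => [|j s] /= mem srt.
  by split=> // -[]; rewrite -mem.
have jmin l : has_cycle_of_length e l -> j <= l.
  rewrite -mem inE => /predU1P[-> //|ls].
  by have /allP/(_ l ls) := order_path_min leq_trans srt.
have jc : has_cycle_of_length e j by rewrite -mem mem_head.
split=> [[<-] // | [kc kmin]]; congr Some; apply/eqP.
by rewrite eqn_leq jmin // kmin.
Qed.

Lemma girth_None (V : finType) (e : rel V) :
  girth e = None <-> forall k, ~~ has_cycle_of_length e k.
Proof.
have mem l : (l \in [seq j <- iota 0 #|V|.+1 | has_cycle_of_length e j])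
             = has_cycle_of_length e l.
  rewrite mem_filter mem_iota add0n ltnS /=.
  by apply/andb_idr; apply: has_cycle_le_card.
rewrite /girth; case: filter mem => [|j s] /= mem; split=> //.
  by move=> _ k; rewrite -mem.
by move/(_ j); rewrite -mem mem_head.
Qed.

End Graph.

Section InclusionGraph.

Local Open Scope group_scope.

Definition nontrivial_proper (gT : finGroupType) (G : {group gT}) :
    pred {group gT} :=
  fun H => (H :!=: 1) && (H \proper G).

Definition proper_subgroup (gT : finGroupType) (G : {group gT}) : finType :=
  {H : {group gT} | nontrivial_proper G H}.

Definition inclusion_graph (gT : finGroupType) (G : {group gT}) :
    rel (proper_subgroup G) :=
  fun H K => (H != K) &&
    ((val H \subset val K) || (val K \subset val H)).

Lemma inclusion_graph_sym (gT : finGroupType) (G : {group gT}) :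
  symmetric (@inclusion_graph gT G).
Proof. by move=> H K; rewrite /inclusion_graph eq_sym orbC. Qed.

Lemma inclusion_graph_irr (gT : finGroupType) (G : {group gT}) :
  irreflexive (@inclusion_graph gT G).
Proof. by move=> H; rewrite /inclusion_graph eqxx. Qed.

(* The non-abelian semidirect product of Z_q by Z_p, for p and q prime;
   p.-primitive_root states that p is the multiplicative order of i mod q. *)
Definition is_Zq_sdprod_Zp (gT : finGroupType) (G : {group gT}) (q p : nat) :
    Prop :=
  (p %| q - 1)%N /\
  exists2 i : nat, (p.-primitive_root (i%:R : 'Z_q))%R &
    G \isog Grp (a : b : (a ^+ q, b ^+ p, b * a * b^-1 = a ^+ i)).

End InclusionGraph.

(* Main.v *)
Require Import Defs.
From mathcomp Require Import all_boot all_algebra.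
From mathcomp Require Import all_fingroup all_solvable.

(** Girth.  If G has no chain 1 < A < B < C < G of subgroups, every edge of the
    inclusion graph joins a minimal subgroup to a maximal one; the graph is then
    bipartite, and it has no 4-cycle because two minimal subgroups below a common
    K generate K.  So it remains to turn an arbitrary cycle into a hexagon
    ([chain3_free_hexagon]).  Such a G is solvable ([chain3_free_solvable], by
    Burnside's transfer theorem), hence has an abelian minimal normal subgroup M.
    If no normal subgroup of G has prime order then M is maximal, and every edge
    turns out to be incident with M, so that there is no cycle
    ([normal_prime_of_cycle]).  If M has prime order, a K not containing M with two
    subgroups A and B gives the hexagon A, K, B, MB, M, MA ([hexagon]).  When
    every K above two vertices of the cycle contains M, any two neighbours K of a
    vertex A <> M of the cycle are equal to MA, which is absurd
    ([hexagon_of_normal_prime]).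

    Claws.  A claw-free graph has maximal degree at most 2.  A noncyclic group has
    at least three non-trivial proper subgroups ([noncyclic_three_subgroups]), so
    all proper subgroups of G are cyclic.
    - For G cyclic, subgroups are divisors of the order, and the list of possible
      orders follows from a few claws of divisors ([no_divisor_claw_order]).
    - For G a noncyclic p-group, three subgroups of the Frattini quotient lift to a
      claw centred at the Frattini subgroup unless the latter is trivial
      ([no_claw_pgroup]).
    - Otherwise the Sylow subgroup P of G for its smallest prime divisor is cyclic
      and not normal, and has a normal complement N by Burnside's transfer theorem.
      A nonnormal subgroup normalised by P has at least three conjugates, because
      the index of P is odd; these conjugates would form a claw with any vertex that
      is normal and lies strictly below or strictly above them.  This forces N and P
      to have prime order, and the presentation follows.

    Conversely, when the order of G divides a product of two primes there is no
    edge at all; a cyclic group whose order is a product of three primes has at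
    most two neighbours for each vertex, and a cyclic group of order p ^ 4 has only
    three vertices. *)

Set Implicit Arguments.
Unset Strict Implicit.
Unset Printing Implicit Defensive.

Local Open Scope group_scope.

(** * Burnside's normal complement theorem *)

Section NormalComplement.

Import FiniteModule.

(** Burnside's fusion argument: P and P :^ g are Sylow subgroups of the centraliser
    of x ^ g, so some c in that centraliser brings P :^ g back to P; then g * c
    normalises P, hence centralises x, and x ^ (g * c) = x ^ g. *)
Lemma conj_in_central_Sylow (gT : finGroupType) (p : nat) (G P : {group gT}) x g :
  p.-Sylow(G) P -> 'N_G(P) \subset 'C(P) -> x \in P -> g \in G -> x ^ g \in P ->
  x ^ g = x.
Proof.
move=> sylP cNP Px Gg Pxg; have sPG := pHall_sub sylP.
have abP : P \subset 'C(P) by rewrite (subset_trans _ cNP) // subsetI sPG normG.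
pose C := 'C_G[x ^ g]%G.
have sylC (Q : {group gT}) : p.-Sylow(G) Q -> Q \subset 'C[x ^ g] -> p.-Sylow(C) Q.
  move=> sylQ cQ; apply: (pHall_subl _ _ sylQ); last exact: subsetIl.
  by rewrite subsetI (pHall_sub sylQ).
have sylP1 : p.-Sylow(C) P by apply: sylC => //; rewrite sub_cent1 (subsetP abP).
have sylP2 : p.-Sylow(C) (P :^ g).
  by apply: sylC; rewrite ?pHallJ // cent1J conjSg sub_cent1 (subsetP abP).
have [c /setIP[Gc /cent1P cx] defP] := Sylow_trans sylP2 sylP1.
have Ngc : g * c \in 'N_G(P).
  by rewrite inE groupM //= inE conjsgM -defP.
have /centP/(_ _ Px) comm_x := subsetP cNP _ Ngc.
transitivity (x ^ (g * c)).
  by rewrite conjgM; apply/esym/conjg_fixP/commgP/commute_sym.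
exact/conjg_fixP/commgP/commute_sym.
Qed.

(** Burnside's normal complement theorem.  The transfer V from G to P raises the
    elements of P to the power #|G : P|: each factor of its cycle expansion is a
    conjugate, lying in P, of a power of the argument, hence equal to it.  As
    #|G : P| is prime to #|P|, the kernel of V meets P trivially, and counting shows
    that it is a complement. *)
Theorem central_Sylow_complement (gT : finGroupType) (p : nat) (G P : {group gT}) :
  p.-Sylow(G) P -> 'N_G(P) \subset 'C(P) -> exists N : {group gT}, N ><| P = G.
Proof.
move=> sylP cNP; have sPG := pHall_sub sylP.
have abP : abelian P by rewrite /abelian (subset_trans _ cNP) // subsetI sPG normG.
have abA : abelian (idm_morphism P @* P) by rewrite morphim_idm.
pose V := transfer_morphism G abA.
have sPA : {subset P <= idm_morphism P @* P} by apply/subsetP; rewrite morphim_idm.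
have VP g : g \in P -> V g = fmod abA (g ^+ #|G : P|).
  move=> Pg; have Gg := subsetP sPG g Pg.
  have trX := transversalP (rcosets_cycle_partition sPG Gg).
  rewrite /= (transfer_cycle_expansion sPG abA Gg trX).
  rewrite -(sum_index_rcosets_cycle sPG Gg trX).
  rewrite fmodX ?sPA // -GRing.sumrMnr; apply: eq_bigr => x Xx.
  have Gx : x \in G := subsetP (transversal_sub trX) x Xx.
  rewrite -fmodX ?sPA //=; congr (fmod _ _).
  apply: (conj_in_central_Sylow sylP); rewrite ?groupV ?groupX //.
  have := mulg_exp_card_rcosets P g x.
  by rewrite mem_rcoset conjgE invgK mulgA.
have tiVP : 'ker V :&: P = 1.
  apply/trivgP/subsetP=> g /setIP[kg Pg]; have := mker kg; rewrite VP //.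
  move/(congr1 val); rewrite /= fmodK ?sPA ?groupX // => g1.
  have co : coprime #|P| #|G : P|.
    by case/and3P: sylP => _ pP p'GP; apply: pnat_coprime pP p'GP.
  by rewrite inE -(expgK co Pg) g1 expg1n.
exists ('ker V)%G; rewrite sdprodE //; last first.
  exact: subset_trans sPG (normal_norm (ker_normal _)).
apply/eqP; rewrite eqEcard mul_subG ?subsetIl //= TI_cardMg //.
have := card_morphim V G; rewrite setIid => cardV.
rewrite -(Lagrange (subsetIl G _ : 'ker V \subset G)) leq_mul2l -cardV.
apply/orP; right.
rewrite -(card_imset _ (val_inj : injective (fmval (abelA := abA)))).
apply: subset_leq_card.
apply/subsetP=> _ /imsetP[u _ ->]; have: val u \in idm_morphism P @* P := valP u.
by rewrite /= morphim_idm.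
Qed.

End NormalComplement.

(** 'N_G(P) / 'C_G(P) is a p'-group that embeds in the automorphism group of P, of
    order p ^ (a - 1) * (p - 1); a prime divisor of its order would be smaller than
    p, the smallest prime divisor of #|G|. *)
Lemma norm_cyclic_Sylow_pdiv (gT : finGroupType) (G P : {group gT}) :
  (pdiv #|G|).-Sylow(G) P -> cyclic P -> 'N_G(P) \subset 'C(P).
Proof.
set p := pdiv _ => sylP cycP.
suffices: #|'N_G(P) : 'C(P)| == 1%N by rewrite indexg_eq1.
apply: contraT => idx_neq1; have idx_gt1 : 1 < #|'N_G(P) : 'C(P)|.
  by rewrite ltn_neqAle eq_sym idx_neq1 indexg_gt0.
have := pdiv_prime idx_gt1; have := pdiv_dvd #|'N_G(P) : 'C(P)|.
set r := pdiv _ => r_dv pr_r.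
have r_dvG : r %| #|G|.
  apply: dvdn_trans r_dv (dvdn_trans (dvdn_indexg _ _) _).
  by rewrite cardSg ?subsetIl.
have le_pr : p <= r by rewrite pdiv_min_dvd // prime_gt1.
have r_dv_tot : r %| totient #|P|.
  rewrite -card_Aut_cyclic //; apply: dvdn_trans r_dv _.
  have <- : #|conj_aut P @* 'N_G(P)| = #|'N_G(P) : 'C(P)|.
    by rewrite card_morphim ker_conj_aut (setIidPr (subsetIr _ _)).
  by rewrite cardSg ?Aut_conj_aut.
have abP := cyclic_abelian cycP; have sPG := pHall_sub sylP.
have pr_p : prime p.
  by rewrite pdiv_prime // (leq_trans (prime_gt1 pr_r)) // dvdn_leq ?cardG_gt0.
have p'r : r != p.
  apply: contraTneq r_dv => ->; rewrite -p'natE // -indexgI.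
  have sPNC : P \subset 'N_G(P) :&: 'C(P) by rewrite !subsetI sPG normG.
  case/and3P: sylP => _ _; apply: pnat_dvd.
  apply: dvdn_trans (indexgS _ sPNC) _.
  by rewrite indexSg ?subsetIl ?subsetI ?sPG ?normG.
have [n cardP] := p_natP (pHall_pgroup sylP : p.-nat #|P|).
move: r_dv_tot; rewrite cardP; case: n {cardP} => [|n].
  by rewrite dvdn1 => /eqP r1; rewrite r1 in pr_r.
rewrite totient_pfactor // Euclid_dvdM // => /orP[r_dv1|].
  have lt0p1 : 0 < p.-1 by rewrite -ltnS prednK ?prime_gt1 ?prime_gt0.
  by have := dvdn_leq lt0p1 r_dv1; rewrite leqNgt prednK ?prime_gt0 ?le_pr.
by rewrite Euclid_dvdX // dvdn_prime2 // (negPf p'r).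
Qed.

(** * Edges and hexagons of the inclusion graph *)

(** All that is retained of a cycle in the search for a hexagon. *)
Definition two_neighbours (V : finType) (e : rel V) (c : seq V) : Prop :=
  {in c, forall x, exists y z, [/\ y \in c, z \in c, y != z, e x y & e x z]}.

Lemma ucycle_two_neighbours (V : finType) (e : rel V) (c : seq V) :
  symmetric e -> ucycleb e c -> 2 < size c ->
  two_neighbours e c.
Proof.
move=> e_sym /andP[cyc_c uniq_c] c_gt2 x /rot_to[i p rot_c].
have mem_p : {subset p <= c}.
  by move=> y py; rewrite -(mem_rot i) rot_c inE py orbT.
have:= c_gt2; have:= cyc_c; have:= uniq_c.
rewrite -(size_rot i) -(rot_cycle i) -(rot_uniq i) rot_c.
case: p mem_p {rot_c} => // y p; case/lastP: p => // p z mem_p.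
move=> /=/and3P[_ y_notin _] /andP[exy].
rewrite rcons_path last_rcons => /andP[_ ezx] _.
exists y, z; split=> //; last by rewrite e_sym.
- by apply: mem_p; rewrite mem_head.
- by apply: mem_p; rewrite inE mem_rcons mem_head orbT.
by apply: contraNneq y_notin => ->; rewrite mem_rcons mem_head.
Qed.

Lemma card_joing_TI (gT : finGroupType) (G M K X : {group gT}) :
  M <| G -> K \subset G -> M :&: K = 1 -> X \subset K ->
  #|M <*> X| = (#|M| * #|X|)%N.
Proof.
move=> nMG sKG tiMK sXK; rewrite norm_joinEr ?TI_cardMg //.
  by apply/trivgP; rewrite -tiMK setIS.
exact: subset_trans (subset_trans sXK sKG) (normal_norm nMG).
Qed.

Definition chain3_free (gT : finGroupType) (G : {group gT}) : Prop :=
  forall A B C : {group gT},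
    A :!=: 1 -> A \proper B -> B \proper C -> C \proper G -> False.

Section InclusionGraph.

Variables (gT : finGroupType) (G : {group gT}).
Implicit Types A B C H K M X Y : {group gT}.

Local Notation adj := (@inclusion_graph gT G).

Lemma inclusion_graphE (u v : proper_subgroup G) :
  adj u v = (val u \proper val v) || (val v \proper val u).
Proof.
rewrite /inclusion_graph andb_orr !properEneq.
by congr (_ && _ || _ && _); last rewrite eq_sym.
Qed.

Lemma has_cycle_of_subgroups (s : seq {group gT}) :
  2 < size s -> all (nontrivial_proper G) s -> uniq [seq gval H | H <- s] ->
  path.cycle (fun H K => (H \proper K) || (K \proper H)) s ->
  has_cycle_of_length adj (size s).
Proof.
move=> s_gt2 vs; have [c s_eq] : exists c : seq (proper_subgroup G), s = map val c.
  elim: s vs {s_gt2} => [|H s IHs] /=; first by exists nil.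
  by case/andP=> vH /IHs[c ->]; exists (Sub H vH :: c).
move: s_gt2; rewrite s_eq -map_comp size_map cycle_map => c_gt2 uniq_c cyc_c.
rewrite /has_cycle_of_length c_gt2 /=; apply/existsP; exists (in_tuple c).
rewrite /ucycleb (eq_cycle inclusion_graphE) cyc_c.
exact: map_uniq uniq_c.
Qed.

Lemma triangle_free_chain3_free :
  ~~ has_cycle_of_length adj 3 -> chain3_free G.
Proof.
move=> no3 A B C ntA sAB sBC sCG.
have sAC := proper_trans sAB sBC.
have nt H : A \proper H -> H :!=: 1.
  by move=> sAH; apply: contraNneq ntA => H1; rewrite -subG1 -H1 proper_sub.
case/negP: no3; apply: (@has_cycle_of_subgroups [:: A; B; C]) => //=.
- rewrite /nontrivial_proper ntA !nt //= sCG (proper_trans sBC) //.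
  by rewrite (proper_trans sAC).
- by rewrite !inE !negb_or !proper_neq.
by rewrite sAB sBC sAC !orbT.
Qed.

Hypothesis chain_free : chain3_free G.

(** A < A <*> B < K would be a chain. *)
Lemma chain3_free_join A B K :
  A :!=: 1 -> A \proper K -> B \proper K -> K \proper G ->
  ~~ (B \subset A) -> A <*> B = K.
Proof.
move=> ntA sAK sBK sKG not_sBA; apply/eqP; rewrite eqEproper join_subG.
rewrite !proper_sub //=; apply/negP=> sJK.
apply: (chain_free ntA _ sJK sKG).
rewrite properEneq joing_subl andbT.
by apply: contra not_sBA => /eqP->; exact: joing_subr.
Qed.

(** The hexagon is A, K, B, M <*> B, M, M <*> A.  As M <*> X has order #|M| * #|X|,
    it is too small to contain K when X < K; this makes M <*> A and M <*> B proper
    and distinct. *)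
Lemma hexagon M A B K :
  M <| G -> prime #|M| -> A :!=: 1 -> B :!=: 1 -> A != B ->
  A \proper K -> B \proper K -> K \proper G -> ~~ (M \subset K) ->
  has_cycle_of_length adj 6.
Proof.
move=> nMG pr_M ntA ntB neAB sAK sBK sKG not_sMK.
have tiMK := prime_TIg pr_M not_sMK.
have ntM : M :!=: 1 by rewrite -cardG_gt1 prime_gt1.
have min_sub X Y : X :!=: 1 -> X \proper Y -> Y \proper K -> False.
  by move=> ntX sXY sYK; exact: (chain_free ntX sXY sYK sKG).
have not_sBA : ~~ (B \subset A).
  apply/negP=> sBA; apply: (min_sub _ _ ntB _ sAK).
  by rewrite properEneq sBA andbT eq_sym.
have not_sAB : ~~ (A \subset B).
  by apply/negP=> sAB; apply: (min_sub _ _ ntA _ sBK); rewrite properEneq sAB andbT.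
have defK := chain3_free_join ntA sAK sBK sKG not_sBA.
have joinM X : X :!=: 1 -> X \proper K ->
    [/\ nontrivial_proper G (M <*> X), M \proper M <*> X,
        X \proper M <*> X & ~~ (K \subset M <*> X)].
  move=> ntX sXK.
  have sXG : X \subset G := subset_trans (proper_sub sXK) (proper_sub sKG).
  have not_sKMX : ~~ (K \subset M <*> X).
    have card_join Y := card_joing_TI nMG (proper_sub sKG) tiMK (X := Y).
    apply/negP=> sKMX; have: M <*> K \subset M <*> X by rewrite join_subG joing_subl.
    move/subset_leq_card; rewrite !card_join ?(proper_sub sXK) //.
    by rewrite leq_pmul2l ?cardG_gt0 // leqNgt proper_card.
  have sXM : X \subset M -> X :=: 1.
    by move=> sXM; apply/trivgP; rewrite -tiMK subsetI sXM proper_sub.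
  split=> //.
  - apply/andP; split.
      by rewrite -subG1 join_subG negb_and subG1 ntM.
    rewrite properEneq join_subG (normal_sub nMG) sXG !andbT.
    by apply: contra not_sKMX => /eqP->; exact: proper_sub.
  - rewrite properE joing_subl join_subG subxx /=.
    by apply: contra ntX => /sXM->.
  rewrite properE joing_subr join_subG subxx andbT /=.
  by apply: contra not_sMK => sMX; apply: subset_trans sMX (proper_sub sXK).
have [vMA sM_MA sA_MA not_sK_MA] := joinM A ntA sAK.
have [vMB sM_MB sB_MB not_sK_MB] := joinM B ntB sBK.
have vtx X : X :!=: 1 -> X \proper G -> nontrivial_proper G X by move=> *; apply/andP.
have vA := vtx A ntA (proper_trans sAK sKG).
have vB := vtx B ntB (proper_trans sBK sKG).
have vM : nontrivial_proper G M.
  by apply: vtx => //; case/andP: vMA => _; exact: proper_trans.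
have vK : nontrivial_proper G K.
  apply: vtx => //; apply: contraNneq ntA => K1.
  by rewrite -subG1 -K1 proper_sub.
have not_sB_MA : ~~ (B \subset M <*> A).
  by apply: contra not_sK_MA; rewrite -defK join_subG joing_subr.
have not_sA_MB : ~~ (A \subset M <*> B).
  by apply: contra not_sK_MB; rewrite -defK join_subG joing_subr andbT.
pose MA := (M <*> A)%G; pose MB := (M <*> B)%G.
apply: (@has_cycle_of_subgroups [:: A; K; B; MB; M; MA]) => //=.
- by rewrite vA vK vB vMB vM vMA.
- have neqP X Y : ~~ (X \subset Y) -> X != Y :> {set gT}.
    by apply: contra => /eqP->.
  have [sMA sMB] : M \subset M <*> A /\ M \subset M <*> B by rewrite !joing_subl.
  have not_sMA : ~~ (M \subset A).
    by apply: contra not_sMK => /subset_trans->; rewrite // proper_sub.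
  have not_sMB : ~~ (M \subset B).
    by apply: contra not_sMK => /subset_trans->; rewrite // proper_sub.
  have not_sBM : ~~ (B \subset M).
    by apply: contra not_sB_MA => /subset_trans->.
  have not_sAM : ~~ (A \subset M).
    by apply: contra not_sA_MB => /subset_trans->.
  have not_sMB_MA : ~~ (M <*> B \subset M <*> A).
    by rewrite join_subG negb_and not_sB_MA orbT.
  rewrite !inE !negb_or neAB !(proper_neq sAK, proper_neq sA_MA, proper_neq sB_MB).
  rewrite (proper_neq sM_MA) (eq_sym (gval K) B) (proper_neq sBK).
  rewrite (eq_sym (gval K) M) (eq_sym (M <*> B) M) (proper_neq sM_MB).
  by rewrite !(neqP A, neqP K (_ <*> _)%G, neqP B, neqP M K, neqP (M <*> B)%G).
by rewrite sAK sBK sM_MA sM_MB sA_MA sB_MB !orbT.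
Qed.

End InclusionGraph.

(** * Groups without long chains of subgroups *)

Lemma chain3_freeS (gT : finGroupType) (G K : {group gT}) :
  K \subset G -> chain3_free G -> chain3_free K.
Proof.
move=> sKG free_G A B C ntA sAB sBC sCK.
exact: free_G ntA sAB sBC (proper_sub_trans sCK sKG).
Qed.

Lemma cyclic_quotient_maximal (gT : finGroupType) (G P : {group gT}) :
  P <| G -> P \proper G ->
  (forall K : {group gT}, P \proper K -> ~~ (K \proper G)) -> cyclic (G / P).
Proof.
move=> nPG /properP[sPG [x Gx P'x]] maxP; have nPx := subsetP (normal_norm nPG) x Gx.
have sXG : P <*> <[x]> \subset G by rewrite join_subG sPG cycle_subG.
have sPX : P \proper P <*> <[x]>.
  rewrite properE joing_subl; apply: contra P'x => /subsetP->//.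
  by rewrite mem_gen // inE cycle_id orbT.
have defG : P <*> <[x]> = G.
  by apply/eqP; have := maxP _ sPX; rewrite properEneq sXG andbT negbK.
rewrite -defG quotientYidl ?cycle_subG // quotient_cycle //.
exact: cycle_cyclic.
Qed.

(** Let P be a Sylow subgroup for the smallest prime divisor of #|G|.  If P is
    cyclic, or is its own normaliser and abelian, then P is central in its
    normaliser, and a normal complement of P is solvable by induction.  If P is not
    cyclic, P contains a proper non-trivial subgroup, so P is maximal; if P is not
    its own normaliser it is then normal, with cyclic quotient. *)
Lemma chain3_free_solvable (gT : finGroupType) (G : {group gT}) :
  chain3_free G -> solvable G.
Proof.
have [n] := ubnP #|G|; elim: n G => // n IHn G /ltnSE-leGn free_G.
have [G1 | ntG] := eqVneq (G : {set gT}) 1; first by rewrite G1 solvable1.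
set p := pdiv #|G|; have [P sylP] := Sylow_exists p G.
have sPG := pHall_sub sylP; have pP : p.-group P := pHall_pgroup sylP.
have pr_p : prime p by rewrite pdiv_prime // cardG_gt1.
have ntP : P :!=: 1.
  rewrite -rank_gt0 (rank_Sylow sylP) p_rank_gt0 mem_primes pr_p cardG_gt0.
  exact: pdiv_dvd.
have [defP | neqPG] := eqVneq (P : {set gT}) G.
  by rewrite -defP (pgroup_sol pP).
have prPG : P \proper G by rewrite properEneq neqPG.
have solve_compl : 'N_G(P) \subset 'C(P) -> solvable G.
  move=> cNP; have [N defG] := central_Sylow_complement sylP cNP.
  have [nNG _ mulNP nNP tiNP] := sdprod_context defG.
  rewrite (series_sol nNG) IHn //=.
  - rewrite -(isog_sol (sdprod_isog defG)) abelian_sol //.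
    by apply: subset_trans cNP; rewrite subsetI sPG normG.
  - apply: leq_trans (proper_card _) leGn; rewrite properEneq (normal_sub nNG) andbT.
    apply: contraNneq ntP => defN; rewrite -tiNP defN.
    by rewrite (setIidPr sPG).
  exact: chain3_freeS (normal_sub nNG) free_G.
have [cycP | not_cycP] := boolP (cyclic P).
  exact: solve_compl (norm_cyclic_Sylow_pdiv sylP cycP).
have [x Px ntx] := trivgPn _ ntP.
have ntX : <[x]> :!=: 1 by rewrite cycle_eq1.
have sXP : <[x]> \proper P.
  rewrite properEneq cycle_subG Px andbT.
  by apply: contraNneq not_cycP => <-; exact: cycle_cyclic.
have maxP (K : {group gT}) : P \proper K -> ~~ (K \proper G).
  by move=> sPK; apply/negP=> sKG; exact: free_G ntX sXP sPK sKG.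
have [defN | ] := eqVneq ('N_G(P) : {set gT}) P; last first.
  rewrite eq_sym => neqPN; have nPG : P <| G.
    rewrite /normal sPG; apply/setIidPl/eqP.
    have := maxP ('N_G(P))%G; rewrite properEneq neqPN subsetI sPG normG /=.
    by rewrite properEneq subsetIl andbT negbK; exact.
  rewrite (series_sol nPG) (pgroup_sol pP) abelian_sol // cyclic_abelian //.
  exact: cyclic_quotient_maximal.
apply: solve_compl; rewrite defN.
(* If P is not abelian, 1 < Z(P) < <Z(P), y> < P < G for y outside Z(P). *)
apply: contraT => nabP; have [y Py Z'y] : exists2 y, y \in P & y \notin 'Z(P).
  by apply/subsetPn; rewrite subsetI subxx.
pose Y := ('Z(P) <*> <[y]>)%G; have sZP := subsetIl P 'C(P).
have sYP : Y \subset P by rewrite join_subG sZP cycle_subG.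
have Yy : y \in Y by rewrite mem_gen // inE cycle_id orbT.
have ntZ : 'Z(P) != 1.
  by apply: contraNneq ntP => /(trivg_center_pgroup pP)->.
have sZY : 'Z(P) \proper Y.
  by rewrite properE joing_subl; apply: contra Z'y => /subsetP->.
case: (free_G _ Y P ntZ sZY _ prPG); rewrite properEneq sYP andbT.
apply: contraNneq nabP => <-.
rewrite -/(abelian Y) abelianY center_abelian cycle_abelian /=.
by rewrite cycle_subG (subsetP _ _ Py) // centsC subsetIr.
Qed.

Section Girth.

Variables (gT : finGroupType) (G : {group gT}).
Hypothesis free_G : chain3_free G.

Local Notation adj := (@inclusion_graph gT G).
Local Notation V := (proper_subgroup G).
Implicit Types (u v w x y z : V) (K : {group gT}).

Lemma vertex_neq1 u : val u :!=: 1.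
Proof. by have /andP[] := valP u. Qed.

Lemma vertex_proper u : val u \proper G.
Proof. by have /andP[] := valP u. Qed.

Lemma vertex_chain u v w : val u \proper val v -> val v \proper val w -> False.
Proof.
by move=> suv svw; apply: free_G (vertex_neq1 u) suv svw (vertex_proper w).
Qed.

Lemma vertex_join u v w :
  val u \proper val w -> val v \proper val w -> u != v ->
  val u <*> val v = val w.
Proof.
move=> suw svw neuv.
apply: (chain3_free_join free_G (vertex_neq1 u) suw svw (vertex_proper w)).
apply/negP=> svu; apply: (@vertex_chain v u w) => //.
by rewrite properEneq svu andbT eq_sym.
Qed.

Lemma join_vertex_inj u v w w' :
  u != v -> val u \proper val w -> val v \proper val w ->
  val u \proper val w' -> val v \proper val w' -> w = w'.
Proof.
move=> neuv uw vw uw' vw'; apply/val_inj/val_inj => /=.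
by rewrite -(vertex_join uw vw neuv) -(vertex_join uw' vw' neuv).
Qed.

Lemma lower_vertex u v w :
  val u \proper val v -> adj u w -> val u \proper val w.
Proof.
move=> suv; rewrite inclusion_graphE => /orP[//|swu].
by case: (vertex_chain swu suv).
Qed.

Lemma upper_vertex u v w :
  val v \proper val u -> adj u w -> val w \proper val u.
Proof.
move=> svu; rewrite inclusion_graphE => /orP[suw|//].
by case: (vertex_chain svu suw).
Qed.

(** Edges are traversed alternately upwards and downwards, so the graph is
    bipartite. *)
Lemma chain3_free_alternate u v w :
  adj u v -> adj v w -> (val v \proper val w) = ~~ (val u \proper val v).
Proof.
rewrite !inclusion_graphE => /orP[uv | vu] /orP[vw | wv].
- by case: (vertex_chain uv vw).
- rewrite uv; apply/negbTE/negP=> vw; exact: vertex_chain vw wv.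
- rewrite vw; apply/esym/negP=> uv; exact: vertex_chain uv vu.
by case: (vertex_chain wv vu).
Qed.

Lemma chain3_free_no_short_cycle k : 2 < k < 6 -> ~~ has_cycle_of_length adj k.
Proof.
move=> k_bounds; apply/negP=> /andP[_ /existsP[c]].
case: k k_bounds c => [|[|[|[|[|[|]]]]]] // _ c;
  case/tupleP: c => x; case/tupleP => y; case/tupleP=> z c.
- rewrite [c]tuple0 /ucycleb /= => /andP[/and4P[xy yz zx _] _].
  have := chain3_free_alternate xy yz; have := chain3_free_alternate yz zx.
  by have := chain3_free_alternate zx xy; do 3 case: (_ \proper _).
- case/tupleP: c => w c; rewrite [c]tuple0 /ucycleb /= !inE !negb_or.
  case/andP=> /and5P[xy yz zw wx _] /and4P[/and3P[_ nexz _] /andP[_ neyw] _ _].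
  have yzE := chain3_free_alternate xy yz; have zwE := chain3_free_alternate yz zw.
  have wxE := chain3_free_alternate zw wx; rewrite zwE yzE negbK in wxE.
  rewrite yzE negbK in zwE.
  move: xy yz zw wx; rewrite !inclusion_graphE wxE zwE yzE.
  case: (boolP (val x \proper val y)) zwE wxE yzE => /=
    [sxy szw _ _ _ szy _ sxw | _ _ swx syz syx _ swz _].
    by case/eqP: neyw; exact: join_vertex_inj nexz sxy szy sxw szw.
  by case/eqP: nexz; exact: join_vertex_inj neyw syx swx syz swz.
case/tupleP: c => w c; case/tupleP: c => v c; rewrite [c]tuple0 /ucycleb /=.
case/andP=> /and5P[xy yz zw wv /andP[vx _]] _.
have := chain3_free_alternate vx xy; have := chain3_free_alternate wv vx.
have := chain3_free_alternate zw wv; have := chain3_free_alternate yz zw.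
by have := chain3_free_alternate xy yz; do 5 case: (_ \proper _).
Qed.

(** An upper vertex K of the cycle lies above two vertices, so [hexagon] applies
    unless M <= K.  If M <= K for all of them, a lower vertex w <> M has two distinct
    neighbours, both equal to w <*> M; hence M is the only lower vertex, although an
    upper vertex has two lower neighbours. *)
Lemma hexagon_of_normal_prime (M : {group gT}) (c : seq V) u0 :
  M <| G -> prime #|M| -> u0 \in c ->
  two_neighbours adj c ->
  has_cycle_of_length adj 6.
Proof.
move=> nMG prM c_u0 nbr2; apply: contraT => no6.
have sMG := normal_sub nMG; have ntM : M :!=: 1 by rewrite -cardG_gt1 prime_gt1.
have upper_M u v : u \in c -> val v \proper val u -> adj u v -> M \subset val u.
  move=> cu svu uv; have [x [y [_ _ nexy ux uy]]] := nbr2 u cu.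
  apply: contraR no6 => not_sMu.
  exact: (hexagon free_G nMG prM (vertex_neq1 x) (vertex_neq1 y) nexy
    (upper_vertex svu ux) (upper_vertex svu uy) (vertex_proper u) not_sMu).
have [u [v [cu cv uv suv]]] : exists u v,
    [/\ u \in c, v \in c, adj u v & val u \proper val v].
  have [v [_ [cv _ _ u0v _]]] := nbr2 u0 c_u0; have := u0v; rewrite inclusion_graphE.
  case/orP=> [s | s]; first by exists u0, v.
  by exists v, u0; rewrite inclusion_graph_sym.
have vu : adj v u by rewrite inclusion_graph_sym.
have lower_M w : w \in c -> adj v w -> val w :=: M.
  move=> cw vw; have swv := upper_vertex suv vw.
  apply/eqP; apply: contraT => newM.
  have joinM x : x \in c -> adj w x -> val w <*> M = val x.
    move=> cx wx; have swx := lower_vertex swv wx.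
    have sMx : M \subset val x.
      by apply: upper_M swx _; rewrite // inclusion_graph_sym.
    have [defM | neMx] := eqVneq (M : {set gT}) (val x).
      by rewrite defM (joing_idPr (proper_sub swx)).
    apply: (chain3_free_join free_G (vertex_neq1 w) swx _ (vertex_proper x)).
      by rewrite properEneq neMx.
    apply/negP=> sMw; apply: (free_G ntM _ swx (vertex_proper x)).
    by rewrite properEneq sMw eq_sym newM.
  have [x [y [cx cy nexy wx wy]]] := nbr2 w cw.
  by case/eqP: nexy; apply/val_inj/val_inj; rewrite /= -(joinM x) // -(joinM y).
have [x [y [cx cy nexy vx vy]]] := nbr2 v cv.
by case/eqP: nexy; apply/val_inj/val_inj; rewrite /= (lower_M x) // (lower_M y).
Qed.

(** Let M be minimal normal, hence abelian, and not of prime order; let A be a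
    subgroup of M of prime order.  If M = G then A is normal; if not, M is a maximal
    subgroup, since M < K < G would extend A < M to a chain.  For an edge
    u < v with v <> M one has M v = G, so M :&: v is normalised by M and by v, and is
    trivial by minimality of M; but then M < M u < G by comparison of orders.  So
    every edge ends in M, and a lower vertex has a single neighbour. *)
Lemma normal_prime_of_cycle (c : seq V) u0 :
  u0 \in c ->
  two_neighbours adj c ->
  exists M : {group gT}, (M <| G) && prime #|M|.
Proof.
move=> c_u0 nbr2.
have ntG : G :!=: 1.
  by apply: contraTneq (vertex_proper u0) => ->; rewrite properE sub1G andbF.
have [M minM sMG] := minnormal_exists ntG (normG G).
have [nMG ntM abelM] := minnormal_solvable minM sMG (chain3_free_solvable free_G).
have nsMG : M <| G by apply/andP.
have abM : abelian M.
  by case/is_abelemP: abelM => p _ /abelem_abelian.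
have [prM | not_prM] := boolP (prime #|M|); first by exists M; rewrite nsMG.
have M_gt1 : 1 < #|M| by rewrite cardG_gt1.
have [a Ma oa] := Cauchy (pdiv_prime M_gt1) (pdiv_dvd _).
pose A := <[a]>%G; have prA : prime #|A| by rewrite -orderE oa pdiv_prime.
have ntA : A :!=: 1 by rewrite -cardG_gt1 prime_gt1.
have sAM : A \proper M.
  by rewrite properEneq cycle_subG Ma andbT; apply: contraNneq not_prM => <-.
have [defM | neMG] := eqVneq (M : {set gT}) G.
  exists A; rewrite prA andbT /normal -defM proper_sub // cents_norm //.
  exact: subset_trans abM (centS (proper_sub sAM)).
have maxM K : M \subset K -> K \proper G -> K :=: M.
  move=> sMK sKG; apply/eqP; apply: contraT => neKM.
  by case: (free_G ntA sAM _ sKG); rewrite properEneq eq_sym neKM.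
have edge_top u v : val u \proper val v -> val v :=: M.
  move=> suv; have svG := proper_sub (vertex_proper v).
  have [sMv | not_sMv] := boolP (M \subset val v).
    exact: maxM sMv (vertex_proper v).
  have joinG K : K \subset G -> ~~ (K \subset M) -> M <*> K = G.
    move=> sKG not_sKM; apply/eqP; apply: contraR not_sKM => neMKG.
    rewrite -(maxM (M <*> K)%G) ?joing_subl ?joing_subr //.
    by rewrite properEneq neMKG join_subG sMG.
  have tiMv : M :&: val v = 1.
    apply/eqP; apply: contraT => ntI; case/negP: (not_sMv); apply/setIidPl.
    case/mingroupP: minM => _ minM; apply: minM; last exact: subsetIl.
    have not_svM : ~~ (val v \subset M).
      apply/negP=> svM; apply: (free_G (vertex_neq1 u) suv (_ : _ \proper M)).
        by rewrite properE svM.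
      by rewrite properEneq neMG.
    rewrite ntI /= -(joinG _ svG not_svM) join_subG; apply/andP; split.
      by rewrite cents_norm // (subset_trans abM) // centS ?subsetIl.
    by rewrite normsI ?normG // (subset_trans svG).
  have not_suM : ~~ (val u \subset M).
    apply: contra (vertex_neq1 u) => suM; rewrite -subG1 -tiMv subsetI suM.
    exact: proper_sub.
  have not_svM : ~~ (val v \subset M).
    by apply: contra not_suM; apply: subset_trans (proper_sub suv).
  have card_join K := card_joing_TI nsMG svG tiMv (X := K).
  have suG := subset_trans (proper_sub suv) svG.
  have: #|M <*> val u| == #|M <*> val v| by rewrite !joinG.
  rewrite !card_join ?(proper_sub suv) // eqn_pmul2l ?cardG_gt0 //.
  by rewrite ltn_eqF ?proper_card.
have no_lower u : u \in c -> (forall v, adj u v -> val u \proper val v) -> False.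
  move=> cu up; have [v [w [_ _ nevw uv uw]]] := nbr2 u cu.
  case/eqP: nevw; apply/val_inj/val_inj; rewrite /=.
  by rewrite (edge_top _ _ (up v uv)) (edge_top _ _ (up w uw)).
have [v [_ [cv _ _ u0v _]]] := nbr2 u0 c_u0; have := u0v; rewrite inclusion_graphE.
case/orP=> s.
  by case: (no_lower u0) => // w; exact: lower_vertex s.
by case: (no_lower v) => // w; exact: lower_vertex s.
Qed.

Lemma chain3_free_hexagon k :
  has_cycle_of_length adj k -> has_cycle_of_length adj 6.
Proof.
case/andP=> k_gt2 /existsP[c cyc_c].
have nbr2 := ucycle_two_neighbours (@inclusion_graph_sym gT G) cyc_c.
rewrite size_tuple in nbr2; have {}nbr2 := nbr2 k_gt2.
have [u0 c_u0] : exists u0, u0 \in tval c.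
  have: 2 < size c by rewrite size_tuple.
  by case: (tval c) => // u0 s _; exists u0; rewrite mem_head.
have [M /andP[nMG prM]] := normal_prime_of_cycle c_u0 nbr2.
exact: hexagon_of_normal_prime nMG prM c_u0 nbr2.
Qed.

End Girth.

Theorem girth_inclusion_graph (gT : finGroupType) (G : {group gT}) :
  girth (@inclusion_graph gT G) \in [:: Some 3; Some 6; None].
Proof.
have [c3 | no3] := boolP (has_cycle_of_length (@inclusion_graph gT G) 3).
  by have/girth_Some-> : has_cycle_of_length (@inclusion_graph gT G) 3 /\
    forall l, has_cycle_of_length (@inclusion_graph gT G) l -> 3 <= l
    by split=> // l /andP[].
have free_G := triangle_free_chain3_free no3.
case E: girth => [k|] //; have [ck kmin] := (girth_Some _ _).1 E.
have := kmin 6 (chain3_free_hexagon free_G ck).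
rewrite leq_eqVlt => /predU1P[-> //|lt_k6].
have := chain3_free_no_short_cycle free_G (k := k); rewrite ck lt_k6 andbT.
by case/andP: ck => -> _ /(_ isT).
Qed.

(** * Claws in the inclusion graph *)

Definition nested (gT : finGroupType) : rel {group gT} :=
  fun H K => (H \proper K) || (K \proper H).

Definition no_claw (gT : finGroupType) (G : {group gT}) : Prop :=
  forall H A B C : {group gT}, all (nontrivial_proper G) [:: H; A; B; C] ->
    uniq [:: A; B; C] -> all (nested H) [:: A; B; C] -> False.

Lemma claw_freeP (gT : finGroupType) (G : {group gT}) :
  subgraph_free (@complete_bipartite 1 3) (@inclusion_graph gT G) <-> no_claw G.
Proof.
split=> [free H A B C | free [f f_inj f_adj]].
  rewrite /= !andbT => /and4P[vH vA vB vC] uniqABC /and3P[cA cB cC].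
  pose leaves := [tuple Sub A vA; Sub B vB; Sub C vC : proper_subgroup G].
  have leaf_adj i : inclusion_graph (Sub H vH) (tnth leaves i).
    by rewrite inclusion_graphE; case: i => -[|[|[|//]]].
  apply: free.
  exists (fun u => match u with inl _ => Sub H vH | inr i => tnth leaves i end).
  - have leaf_neq i : tnth leaves i != Sub H vH.
      apply: contraTneq (leaf_adj i) => ->; exact/negbT/inclusion_graph_irr.
    move=> [i|i] [j|j] //=; first by rewrite !ord1.
    + by move/esym/eqP; rewrite (negPf (leaf_neq j)).
    + by move/eqP; rewrite (negPf (leaf_neq i)).
    have uniq_leaves : uniq leaves.
      by apply: (@map_uniq _ _ val); rewrite /= andbT.
    rewrite !(tnth_nth (Sub H vH)) => /eqP; rewrite nth_uniq ?size_tuple //.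
    by move/eqP/val_inj->.
  by move=> [i|i] [j|j] //= _; rewrite 1?inclusion_graph_sym leaf_adj.
pose leaf i : {group gT} := val (f (inr i)).
apply: (free (val (f (inl ord0))) (leaf (@Ordinal 3 0 isT))
  (leaf (@Ordinal 3 1 isT)) (leaf (@Ordinal 3 2 isT))).
- by rewrite /= !(valP (f _)).
- by rewrite /= !inE !negb_or !(inj_eq val_inj) !(inj_eq f_inj).
by rewrite /= /nested -!inclusion_graphE !f_adj.
Qed.

(** Take the cyclic groups generated by some x <> 1, some y outside <[x]>, and a
    third element outside both of them, which exists since a group is not the union
    of two proper subgroups. *)
Lemma noncyclic_three_subgroups (gT : finGroupType) (H : {group gT}) :
  ~~ cyclic H -> exists A B C : {group gT},
    all (nontrivial_proper H) [:: A; B; C] && uniq [:: A; B; C].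
Proof.
move=> not_cycH.
have vertex_cycle x : x \in H -> x != 1 -> nontrivial_proper H <[x]>.
  move=> Hx ntx; rewrite /nontrivial_proper cycle_eq1 ntx properEneq cycle_subG Hx.
  by rewrite andbT; apply: contraNneq not_cycH => <-; exact: cycle_cyclic.
have outside x : x \in H -> exists2 y, y \in H & y \notin <[x]>.
  move=> Hx; apply/subsetPn; apply: contra not_cycH => sHX.
  exact: cyclicS sHX (cycle_cyclic x).
have nt_out (x y : gT) : y \notin <[x]> -> y != 1.
  by apply: contraNneq => ->; exact: group1.
have ne_out (x y : gT) : y \in <[x]> = false -> <[x]>%G != <[y]>%G.
  by move=> xy; apply/eqP=> /(congr1 val)/= E; rewrite E cycle_id in xy.
have [x Hx ntx] : exists2 x, x \in H & x != 1.
  by apply/trivgPn; apply: contraNneq not_cycH => ->; exact: cyclic1.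
have [y Hy xy] := outside x Hx.
have [z [Hz xz yz]] : exists z, [/\ z \in H, z \notin <[x]> & z \notin <[y]>].
  have [yx | yx] := boolP (x \in <[y]>).
    have [z Hz yz] := outside y Hy; exists z; split=> //.
    by apply: contra yz; apply: subsetP; rewrite cycle_subG.
  by exists (x * y); rewrite groupM // groupMl ?cycle_id // groupMr ?cycle_id.
exists <[x]>%G, <[y]>%G, <[z]>%G.
apply/andP; split.
  rewrite /= (vertex_cycle x) // !vertex_cycle //; first exact: nt_out xz.
  exact: nt_out xy.
by rewrite /= !inE negb_or !ne_out //; exact/negbTE.
Qed.

Section NoClaw.

Variables (gT : finGroupType) (G : {group gT}).
Hypothesis freeG : no_claw G.
Implicit Types (A B C H K M N P Q X : {group gT}).

Lemma no_claw_cyclic K : K \proper G -> cyclic K.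
Proof.
move=> sKG; apply: contraT => not_cycK.
have [A [B [C /andP[vABC uniqABC]]]] := noncyclic_three_subgroups not_cycK.
have sub X : nontrivial_proper K X -> nontrivial_proper G X && nested K X.
  case/andP=> ntX sXK; rewrite /nontrivial_proper ntX (proper_trans sXK) //.
  by rewrite /nested sXK orbT.
move: vABC => /= /and4P[/sub/andP[vA cA] /sub/andP[vB cB] /sub/andP[vC cC] _].
case: (@freeG K A B C) => //; last by rewrite /= cA cB cC.
rewrite /= vA vB vC /nontrivial_proper sKG !andbT.
by apply: contraNneq not_cycK => ->; exact: cyclic1.
Qed.

(** If the Frattini subgroup Phi is non-trivial, it is the centre of a claw: G / Phi
    is not cyclic, so three subgroups lie strictly between Phi and G.  So G is
    elementary abelian, and a subgroup of order p ^ 2, not being cyclic, is G. *)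
Lemma no_claw_pgroup (p : nat) :
  p.-group G -> ~~ cyclic G -> p.-abelem G /\ #|G| = (p ^ 2)%N.
Proof.
move=> pG not_cycG.
have [Phi1 | ntPhi] := eqVneq 'Phi(G) 1; last first.
  have /noncyclic_three_subgroups[A [B [C]]] : ~~ cyclic (G / 'Phi(G)).
    by apply: contra not_cycG; exact: Phi_quotient_cyclic.
  have nPhiG : 'Phi(G) <| G := Phi_normal G.
  have pre (X : {group coset_of 'Phi(G)}) : nontrivial_proper (G / 'Phi(G)) X ->
      exists2 Y : {group gT}, (nontrivial_proper G Y) && ('Phi(G) \proper Y)
        & X = (Y / 'Phi(G))%G.
    case/andP=> ntX sXG; exists (coset 'Phi(G) @*^-1 X)%G; last first.
      by apply/val_inj; rewrite /= cosetpreK.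
    have sY : 'Phi(G) \proper coset 'Phi(G) @*^-1 X.
      rewrite properEneq sub_cosetpre andbT; apply: contraNneq ntX => defY.
      by rewrite -(cosetpreK X) -defY trivg_quotient.
    rewrite /nontrivial_proper sY andbT; apply/andP; split.
      by apply: contraTneq sY => ->; rewrite properE sub1G andbF.
    by move: sXG; rewrite -(cosetpre_proper X) (quotientGK nPhiG).
  case/andP=> /= /and4P[/pre[A' /andP[vA sA] ->] /pre[B' /andP[vB sB] ->]].
  case/pre=> C' /andP[vC sC] -> _ uniqABC.
  case: (@freeG 'Phi(G)%G A' B' C'); first 1 last.
  - by apply: (@map_uniq _ _ (fun X => X / 'Phi(G))%G).
  - by rewrite /= /nested sA sB sC.
  rewrite /= vA vB vC /nontrivial_proper ntPhi !andbT /=.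
  by case/andP: vA => _; apply: proper_trans.
have abelG : p.-abelem G by rewrite -(trivg_Phi pG) Phi1.
split=> //; have rank_gt1 : 1 < logn p #|G|.
  by rewrite ltnNge -(abelem_cyclic abelG).
have [Q [sQG _ oQ]] := normal_pgroup pG (normal_refl G) rank_gt1.
have pr_p : prime p by move: rank_gt1; rewrite lognE; case: prime.
have [<- // | neQG] := eqVneq (Q : {set gT}) G.
have /no_claw_cyclic : Q \proper G by rewrite properEneq neQG.
by rewrite (abelem_cyclic (abelemS sQG abelG)) oQ pfactorK.
Qed.

End NoClaw.

(** * Cyclic groups without claws *)

Lemma cyclic_subgroup_of_order (gT : finGroupType) (G : {group gT}) d :
  cyclic G -> d %| #|G| -> exists2 D : {group gT}, D \subset G & #|D| = d.
Proof.
case/cyclicP=> x defG /dvdnP[k oG]; exists <[x ^+ k]>%G.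
  by rewrite defG cycleX.
have k_gt0 : 0 < k by move: (cardG_gt0 G); rewrite oG; case: k {oG}.
have ox : #[x] = (k * d)%N by rewrite -oG defG.
by rewrite -[#|_|]/#[_] orderXdiv ?ox ?dvdn_mulr // mulKn.
Qed.

Definition proper_divisor n d := [&& d %| n, d != 1%N & d != n].

Definition no_divisor_claw n := forall h a b c : nat,
  all (proper_divisor n) [:: h; a; b; c] -> uniq [:: a; b; c] ->
  all (fun d => (h != d) && ((h %| d) || (d %| h))) [:: a; b; c] -> False.

Lemma card_vertex (gT : finGroupType) (G H : {group gT}) :
  H \subset G -> nontrivial_proper G H = proper_divisor #|G| #|H|.
Proof.
move=> sHG; rewrite /nontrivial_proper /proper_divisor trivg_card1 cardSg //=.
by rewrite properEcard sHG ltn_neqAle subset_leq_card // andbT.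
Qed.

Lemma no_claw_no_divisor_claw (gT : finGroupType) (G : {group gT}) :
  cyclic G -> no_claw G -> no_divisor_claw #|G|.
Proof.
move=> cycG freeG h a b c /=/and5P[vh va vb vc _] uniqabc /and4P[ha hb hc _].
have sub d : proper_divisor #|G| d -> exists2 D : {group gT}, D \subset G & #|D| = d.
  by case/andP=> d_dv _; exact: cyclic_subgroup_of_order.
have [[H sH oH] [A sA oA]] := (sub h vh, sub a va).
have [[B sB oB] [C sC oC]] := (sub b vb, sub c vc).
have comp (D : {group gT}) :
    D \subset G -> (h != #|D|) && ((h %| #|D|) || (#|D| %| h)) -> nested H D.
  move=> sD; rewrite -oH !(cardSg_cyclic cycG) // /nested !properEcard !ltn_neqAle.
  case/andP=> neHD /orP[] s; rewrite s (subset_leq_card s) andbT ?neHD //.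
  by rewrite eq_sym neHD orbT.
case: (freeG H A B C).
- by rewrite /= !card_vertex // oH oA oB oC vh va vb vc.
- apply: (@map_uniq _ _ (fun D : {group gT} => #|D|)).
  by rewrite /= oA oB oC.
by rewrite /= !comp // ?oA ?oB ?oC.
Qed.

Lemma proper_divisorM d e : 1 < d -> 1 < e -> proper_divisor (d * e)%N d.
Proof.
move=> d_gt1 e_gt1; rewrite /proper_divisor dvdn_mulr // gtn_eqF //=.
by rewrite -{1}(muln1 d) eqn_pmul2l 1?ltnW // eq_sym gtn_eqF.
Qed.

(** A prime power p ^ a with a > 4 has the claw of centre p and leaves p ^ 2, p ^ 3,
    p ^ 4.  If distinct primes p and q divide n, and r is a prime divisor of
    n / (p * q), then p * q is the centre of a claw with leaves p, q and p * q * r,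
    unless p * q * r = n. *)
Lemma no_divisor_claw_order n :
  1 < n -> ~~ prime n -> no_divisor_claw n ->
  [\/ exists p alpha, [/\ prime p, alpha \in [:: 2; 3; 4] & n = p ^ alpha],
      exists p q alpha, [/\ prime p, prime q, p != q, alpha \in [:: 1; 2]
                          & n = p ^ alpha * q]
    | exists p q r, [/\ prime p, prime q, prime r,
                        [/\ p != q, p != r & q != r] & n = p * q * r]]%N.
Proof.
move=> n_gt1 not_pr_n free; have pr_p := pdiv_prime n_gt1.
set p := pdiv n in pr_p; have n_gt0 := ltnW n_gt1.
have p_gt0 := prime_gt0 pr_p; have p_gt1 := prime_gt1 pr_p.
have [/p_natP[a def_n] | ] := boolP (p.-nat n)%N.
  constructor 1; exists p, a; split=> //.
  rewrite def_n in n_gt1 not_pr_n free.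
  case: a n_gt1 not_pr_n free {def_n} => [|[|[|[|[|a]]]]] // _ not_pr free.
    by case/negP: not_pr.
  have vexp k : 0 < k < a.+4.+1 -> proper_divisor (p ^ a.+4.+1) (p ^ k).
    case/andP=> k_gt0 k_lt; rewrite -(subnKC (ltnW k_lt)) expnD.
    by rewrite proper_divisorM // -(expn0 p) ltn_exp2l // subn_gt0.
  case: (@free (p ^ 1) (p ^ 2) (p ^ 3) (p ^ 4))%N.
  - by rewrite /= !vexp.
  - by rewrite /= !inE !eqn_exp2l.
  by rewrite /= !dvdn_Pexp2l // !eqn_exp2l.
rewrite /pnat n_gt0 /= => /allPn[q]; rewrite mem_primes => /and3P[pr_q _ q_dv].
rewrite -topredE /= => neqp.
have neq_pq : p != q by rewrite eq_sym.
have [q_gt0 q_gt1] := (prime_gt0 pr_q, prime_gt1 pr_q).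
have [s def_n] : exists s, n = (p * q * s)%N.
  have /dvdnP[s ->] : p * q %| n; last by exists s; rewrite mulnC.
  by rewrite Gauss_dvd ?pdiv_dvd ?q_dv // prime_coprime // dvdn_prime2.
have [s1 | s_neq1] := eqVneq s 1%N.
  by constructor 2; exists p, q, 1%N; rewrite def_n s1 muln1 expn1.
have s_gt0 : 0 < s by move: n_gt0; rewrite def_n; case: (s); rewrite ?muln0.
have s_gt1 : 1 < s by rewrite ltn_neqAle eq_sym s_neq1.
have pr_r := pdiv_prime s_gt1; have /dvdnP[t def_s] := pdiv_dvd s.
set r := pdiv s in pr_r def_s.
have r_gt1 := prime_gt1 pr_r.
have t1 : t = 1%N.
  apply/eqP; apply: contraT => t_neq1.
  have t_gt1 : 1 < t.
    by move: s_gt0 t_neq1; rewrite def_s; case: (t) => [|[|]].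
  have gt1M d e : 1 < d -> 1 < e -> (1 < d * e)%N.
    by move=> d_gt1 e_gt1; rewrite (leq_trans d_gt1) // leq_pmulr // ltnW.
  have neM d e : 1 < d -> 1 < e -> (d == d * e)%N = false.
    by move=> d1 e1; have /and3P[_ _ /negPf] := proper_divisorM d1 e1.
  case: (free (p * q) p q (p * q * r))%N.
  - rewrite /= def_n def_s mulnA mulnAC.
    rewrite [X in [&& _, _, _, X & _]]proper_divisorM ?gt1M //.
    rewrite -!mulnA [X in [&& _, X & _]]proper_divisorM ?gt1M // (mulnCA p).
    rewrite [X in [&& _, _, X & _]]proper_divisorM ?gt1M //.
    by rewrite (mulnCA q) mulnA proper_divisorM ?gt1M.
  - rewrite /= !inE negb_or neq_pq -mulnA neM ?gt1M //.
    by rewrite mulnCA neM ?gt1M.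
  rewrite /= dvdn_mulr // dvdn_mull // dvdn_mulr // neM ?gt1M // !orbT !andbT.
  by rewrite ![(_ * _)%N == _]eq_sym neM // mulnC neM.
have def_r : s = r by rewrite def_s t1 mul1n.
have [eq_pr | neq_pr] := eqVneq p r.
  by constructor 2; exists p, q, 2; rewrite def_n def_r -eq_pr mulnAC.
have [eq_qr | neq_qr] := eqVneq q r.
  constructor 2; exists q, p, 2.
  by rewrite def_n def_r -eq_qr eq_sym neq_pq -mulnA mulnC.
by constructor 3; exists p, q, r; rewrite def_n def_r.
Qed.

(** * Nonnormal Sylow subgroups in groups without claws *)

Section Conjugates.

Variables (gT : finGroupType) (G : {group gT}).
Hypothesis freeG : no_claw G.
Implicit Types (A B C H K M N P Q X : {group gT}).

(** The number of conjugates of X divides #|G : P|, so it is odd. *)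
Lemma nonnormal_three_conjugates P X :
  P \subset G -> odd #|G : P| -> P \subset 'N(X) -> X \subset G -> ~~ (X <| G) ->
  exists A B C, uniq [:: A; B; C] /\
    {in [:: A; B; C], forall Y, exists2 g, g \in G & Y = (X :^ g)%G}.
Proof.
move=> sPG odd_i nXP sXG; rewrite /normal sXG -indexg_eq1 => i_neq1.
have i_gt2 : 2 < #|X :^: G|.
  have : odd #|G : 'N(X)|.
    rewrite -indexgI; apply: dvdn_odd odd_i.
    by rewrite indexgS // subsetI sPG.
  have := indexg_gt0 G 'N(X); rewrite card_conjugates indexgI.
  by case: #|_ : _| i_neq1 => [|[|[|]]].
have [U [V [W [[/imsetP[a Ga ->] /imsetP[b Gb ->] /imsetP[c Gc ->]] [ab bc ca]]]]] :=
  card_gt2P i_gt2.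
exists (X :^ a)%G, (X :^ b)%G, (X :^ c)%G; split.
  by apply: (@map_uniq _ _ (@gval gT)); rewrite /= !inE negb_or ab bc eq_sym ca.
by move=> Y; rewrite !inE => /or3P[] /eqP->; [exists a | exists b | exists c].
Qed.

(** Otherwise M is the centre of a claw whose leaves are conjugates of X. *)
Lemma no_claw_normal_above P M X :
  P \subset G -> odd #|G : P| -> P \subset 'N(X) ->
  M <| G -> M :!=: 1 -> M \proper X -> X \proper G -> X <| G.
Proof.
move=> sPG odd_i nXP nMG ntM sMX sXG; apply: contraT => nnX.
have [A [B [C [uniqABC conjX]]]] :=
  nonnormal_three_conjugates sPG odd_i nXP (proper_sub sXG) nnX.
have leaf Y : Y \in [:: A; B; C] -> nontrivial_proper G Y && nested M Y.
  move=> /conjX[g Gg ->]; have sMXg : M \proper X :^ g.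
    by rewrite -(normsP (normal_norm nMG) g Gg) properJ.
  rewrite /nontrivial_proper /nested /= sMXg /= andbT.
  rewrite -[gval G](conjGid Gg) properJ sXG andbT.
  by apply: contraNneq ntM => X1; rewrite -subG1 -X1 proper_sub.
case: (@freeG M A B C) => //; last first.
  by apply/allP=> Y /leaf/andP[].
rewrite [all _ _]/(_ && all _ [:: A; B; C]) /nontrivial_proper ntM.
rewrite (proper_trans sMX sXG).
by apply/allP=> Y /leaf/andP[].
Qed.

(** Otherwise K is the centre of a claw whose leaves are conjugates of X. *)
Lemma no_claw_normal_below P K X :
  P \subset G -> odd #|G : P| -> P \subset 'N(X) ->
  K <| G -> K \proper G -> X :!=: 1 -> X \proper K -> X <| G.
Proof.
move=> sPG odd_i nXP nKG prK ntX sXK; apply: contraT => nnX.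
have sXG := subset_trans (proper_sub sXK) (proper_sub prK).
have [A [B [C [uniqABC conjX]]]] := nonnormal_three_conjugates sPG odd_i nXP sXG nnX.
have leaf Y : Y \in [:: A; B; C] -> nontrivial_proper G Y && nested K Y.
  move=> /conjX[g Gg ->]; have sXgK : X :^ g \proper K.
    by rewrite -(normsP (normal_norm nKG) g Gg) properJ.
  rewrite /nontrivial_proper /nested /= sXgK orbT /= andbT (proper_trans sXgK) // andbT.
  by rewrite conjsg_eq1.
case: (@freeG K A B C) => //; last first.
  by apply/allP=> Y /leaf/andP[].
rewrite [all _ _]/(_ && all _ [:: A; B; C]) /nontrivial_proper prK andbT.
apply/andP; split; last by apply/allP=> Y /leaf/andP[].
by apply: contraNneq ntX => K1; rewrite -subG1 -K1 proper_sub.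
Qed.

(** Let M be a subgroup of prime order of N, characteristic in N as N is cyclic.
    If M <> N then M < M P < G, so M P is normal in G by [no_claw_normal_above], and
    then P < M P is normal by [no_claw_normal_below]. *)
Lemma no_claw_prime_kernel N P :
  N ><| P = G -> odd #|N| -> cyclic N -> P :!=: 1 -> N :!=: 1 -> ~~ (P <| G) ->
  prime #|N|.
Proof.
move=> defG oddN cycN ntP ntN nnP.
have [nNG sPG mulNP nNP tiNP] := sdprod_context defG.
have odd_i : odd #|G : P| by rewrite -divgS // -(sdprod_card defG) mulnK ?cardG_gt0.
have N_gt1 : 1 < #|N| by rewrite cardG_gt1.
have [x Nx ox] := Cauchy (pdiv_prime N_gt1) (pdiv_dvd _).
pose M := <[x]>%G; have prM : prime #|M| by rewrite -orderE ox pdiv_prime.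
have sMN : M \subset N by rewrite cycle_subG.
have [<- // | neMN] := eqVneq (M : {set gT}) N.
have ntM : M :!=: 1 by rewrite -cardG_gt1 prime_gt1.
have nMG : M <| G by apply: char_normal_trans nNG; rewrite sub_cyclic_char.
case/negP: nnP; pose MP := (M <*> P)%G.
have tiMP : M :&: P = 1 by apply/trivgP; rewrite -tiNP setSI.
have cMP : #|MP| = (#|M| * #|P|)%N.
  exact: card_joing_TI nMG sPG tiMP (subxx P).
have prMP : MP \proper G.
  rewrite properEcard join_subG sPG normal_sub //= cMP -(sdprod_card defG).
  by rewrite ltn_pmul2r ?cardG_gt0 // proper_card // properEneq neMN.
have sM_MP : M \proper MP.
  rewrite properEcard joing_subl cMP -{1}(muln1 #|M|) ltn_pmul2l ?cardG_gt0 //.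
  by rewrite cardG_gt1.
have sP_MP : P \proper MP.
  rewrite properEcard joing_subr cMP -{1}(mul1n #|P|) ltn_pmul2r ?cardG_gt0 //.
  by rewrite cardG_gt1.
have nMP : MP <| G.
  apply: (no_claw_normal_above sPG odd_i _ nMG ntM sM_MP prMP).
  exact: subset_trans (joing_subr M P) (normG _).
exact: (no_claw_normal_below sPG odd_i (normG P) nMP prMP ntP sP_MP).
Qed.

(** Let Q be a subgroup of prime order of P.  If Q <> P then N Q is a proper, hence
    cyclic, subgroup; so Q is centralised by N as well as by the abelian group P.
    Thus Q is normal in G, and P > Q is normal by [no_claw_normal_above]. *)
Lemma no_claw_prime_complement N P :
  N ><| P = G -> odd #|N| -> abelian P -> P :!=: 1 -> N :!=: 1 -> ~~ (P <| G) ->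
  prime #|P|.
Proof.
move=> defG oddN abP ntP ntN nnP.
have [nNG sPG mulNP nNP tiNP] := sdprod_context defG.
have odd_i : odd #|G : P| by rewrite -divgS // -(sdprod_card defG) mulnK ?cardG_gt0.
have P_gt1 : 1 < #|P| by rewrite cardG_gt1.
have [y Py oy] := Cauchy (pdiv_prime P_gt1) (pdiv_dvd _).
pose Q := <[y]>%G; have prQ : prime #|Q| by rewrite -orderE oy pdiv_prime.
have sQP : Q \subset P by rewrite cycle_subG.
have [<- // | neQP] := eqVneq (Q : {set gT}) P.
have ntQ : Q :!=: 1 by rewrite -cardG_gt1 prime_gt1.
have {}sQP : Q \proper P by rewrite properEneq neQP.
have prP : P \proper G.
  rewrite properEcard sPG -(sdprod_card defG) -{1}(mul1n #|P|) ltn_pmul2r ?cardG_gt0 //.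
  by rewrite cardG_gt1.
have sQG := subset_trans (proper_sub sQP) sPG.
have prNQ : N <*> Q \proper G.
  rewrite properEcard join_subG sQG normal_sub //=.
  rewrite (card_joing_TI nNG sPG tiNP (proper_sub sQP)) -(sdprod_card defG).
  by rewrite ltn_pmul2l ?cardG_gt0 // proper_card.
have abNQ := cyclic_abelian (no_claw_cyclic freeG prNQ).
have nQG : Q <| G.
  rewrite /normal sQG -mulNP mul_subG // cents_norm //.
    apply: (centSS (joing_subl N Q) (joing_subr N Q)); exact: abNQ.
  by rewrite (centSS _ _ abP) // proper_sub.
case/negP: nnP.
exact: (no_claw_normal_above sPG odd_i (normG P) nQG ntQ sQP prP).
Qed.

End Conjugates.

(** * Presentation of the nonabelian groups of order pq *)

Lemma conj_iter_expg (gT : finGroupType) (x z : gT) i k :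
  x ^ z = x ^+ i -> x ^ (z ^+ k) = x ^+ (i ^ k).
Proof.
move=> xz; elim: k => [|k IHk]; first by rewrite conjg1.
by rewrite expgSr conjgM IHk conjXg xz -expgM expnS.
Qed.

(** p is prime, so the order of i, which divides p and is not 1, is p; it divides
    q - 1 by Fermat's little theorem. *)
Lemma primitive_root_mod_prime p q i :
  prime p -> prime q -> i ^ p = 1 %[mod q] -> i <> 1 %[mod q] ->
  (p.-primitive_root (i%:R : 'Z_q))%R /\ p %| q - 1.
Proof.
move=> pr_p pr_q ip1 i_neq1; have q_gt1 := prime_gt1 pr_q.
have natZ k l : k = l %[mod q] <-> (k%:R : 'Z_q)%R = (l%:R)%R.
  split=> [kl | /(congr1 val)]; last by rewrite /= !val_Zp_nat.
  by apply: val_inj; rewrite /= !val_Zp_nat.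
have zp1 : ((i%:R : 'Z_q) ^+ p = 1)%R by rewrite -GRing.natrX; exact: (natZ _ 1%N).1.
have prim : (p.-primitive_root (i%:R : 'Z_q))%R.
  have [m prim_m m_dv] := prim_order_exists (prime_gt0 pr_p) zp1.
  suffices m_neq1 : m != 1%N by rewrite -(prime_nt_dvdP pr_p m_neq1 m_dv).
  apply/eqP=> m1; case: i_neq1; apply: (natZ _ 1%N).2.
  by have := prim_expr_order prim_m; rewrite m1 GRing.expr1.
split=> //; rewrite (prim_order_dvd prim) subn1.
have co_iq : coprime i q.
  rewrite coprime_sym prime_coprime //; apply/negP=> q_dv_i.
  have : i ^ p = 0 %[mod q].
    by apply/eqP; rewrite mod0n -/(dvdn _ _) dvdn_exp ?prime_gt0.
  by rewrite ip1 mod0n modn_small.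
apply/eqP; rewrite -GRing.natrX; apply: (natZ _ 1%N).1.
by have := Euler_exp_totient co_iq; rewrite totient_prime.
Qed.

(** In a group generated by u and v satisfying the relations, u and v have orders
    dividing those of x and y, and conjugation by v^-1 acts on u as y^-1 acts on x;
    so x |-> u and y |-> v extend to the semidirect product. *)
Lemma sdprod_cycle_presentation (gT : finGroupType) (G : {group gT}) (x y : gT) i :
  <[x]> ><| <[y]> = G -> x ^ y^-1 = x ^+ i ->
  G \isog Grp (a : b : (a ^+ #[x], b ^+ #[y], b * a * b^-1 = a ^+ i)).
Proof.
move=> defG xy.
have [nXG sYG mulXY nXY tiXY] := sdprod_context defG.
have conjV (rT : finGroupType) (a b : rT) : b * a * b^-1 = a ^ b^-1.
  by rewrite conjgE invgK mulgA.
apply: intro_isoGrp => [|rT H].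
  apply/existsP; exists (x, y); rewrite /= !xpair_eqE !expg_order !eqxx conjV xy eqxx.
  by rewrite norm_joinEr ?mulXY ?eqxx.
case/existsP=> -[u v] /= /eqP[defH ux vy]; rewrite conjV => uv.
have dvd_u : #[u] %| #[x] by rewrite order_dvdn ux.
have dvd_v : #[v] %| #[y] by rewrite order_dvdn vy.
have actf : {in <[x]> & <[y]>, morph_act 'J 'J (eltm dvd_u) (eltm dvd_v)}.
  move=> a b /cycleP[j ->]; rewrite -cycleV => /cycleP[k ->] /=.
  have Vy : y^-1 \in <[y]> by rewrite groupV cycle_id.
  have -> : eltm dvd_v (y^-1 ^+ k) = v^-1 ^+ k.
    by rewrite morphX // morphV ?cycle_id //= eltm_id.
  rewrite conjXg (conj_iter_expg k xy).
  by rewrite -expgM !eltmE conjXg (conj_iter_expg k uv) -expgM.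
apply/homgP; exists (sdprodm_morphism defG actf).
rewrite im_sdprodm !morphim_cycle ?cycle_id //= !eltm_id -defH norm_joinEr //.
by rewrite /= -cycleV norms_cycle uv mem_cycle.
Qed.

Lemma sdprod_prime_is_Zq_sdprod_Zp (gT : finGroupType) (G N P : {group gT}) :
  N ><| P = G -> prime #|N| -> prime #|P| -> ~~ (P <| G) ->
  is_Zq_sdprod_Zp G #|N| #|P|.
Proof.
move=> defG prN prP nnP.
have [nNG sPG mulNP nNP tiNP] := sdprod_context defG.
have [/cyclicP[x defN] /cyclicP[y defP]] := (prime_cyclic prN, prime_cyclic prP).
have /cycleP[i xy] : x ^ y^-1 \in <[x]>.
  rewrite -defN memJ_norm ?defN ?cycle_id // -defN groupV (subsetP nNP) //.
  by rewrite defP cycle_id.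
have oN : #|N| = #[x] by rewrite defN.
have oP : #|P| = #[y] by rewrite defP.
have ip1 : i ^ #|P| = 1 %[mod #|N|].
  rewrite oN; apply/eqP; rewrite -eq_expg_mod_order -(conj_iter_expg #|P| xy).
  by rewrite expgVn oP expg_order invg1 conjg1.
have i_neq1 : i <> 1 %[mod #|N|].
  move=> i1; case/negP: nnP; rewrite /normal sPG -mulNP mul_subG ?normG //.
  have /conjg_fixP/commgP/commuteV : x ^ y^-1 = x.
    by rewrite xy; apply/eqP; rewrite -{2}(expg1 x) eq_expg_mod_order -oN i1.
  rewrite invgK => cxy; rewrite cents_norm // defN defP cent_cycle cycle_subG.
  exact/cent1P/commute_sym.
have [prim p_dv] := primitive_root_mod_prime prP prN ip1 i_neq1.
split=> //; exists i => //; rewrite oN oP; apply: sdprod_cycle_presentation => //.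
by rewrite -defN -defP.
Qed.

Lemma is_Zq_sdprod_Zp_dvd (gT : finGroupType) (G : {group gT}) p q :
  is_Zq_sdprod_Zp G q p -> #|G| %| p * q.
Proof.
case=> _ [i _ /isoGrp_hom/existsP[[x y] /= /eqP[defG xq yp xy]]].
have nXY : <[y]> \subset 'N(<[x]>).
  by rewrite -cycleV norms_cycle conjgE invgK mulgA xy mem_cycle.
rewrite -defG norm_joinEr //; apply: (@dvdn_trans (#|<[x]>| * #|<[y]>|)).
  by rewrite mul_cardG dvdn_mulr.
by rewrite mulnC dvdn_mul // -orderE order_dvdn ?xq ?yp.
Qed.

(** * Groups with few subgroups have no claws *)

Lemma proper_divisor_mul2 s t d :
  prime s -> prime t -> proper_divisor (s * t)%N d -> d = s \/ d = t.
Proof.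
move=> pr_s pr_t /and3P[d_dv d_neq1 d_neqst].
have [/dvdnP[e def_d] | not_sd] := boolP (s %| d).
  left; rewrite def_d mulnC dvdn_pmul2l ?prime_gt0 // in d_dv.
  have [e1 | e_neq1] := eqVneq e 1%N; first by rewrite def_d e1 mul1n.
  by case/eqP: d_neqst; rewrite def_d (prime_nt_dvdP pr_t e_neq1 d_dv) mulnC.
right; apply: (prime_nt_dvdP pr_t d_neq1).
by rewrite Gauss_dvdr // coprime_sym prime_coprime in d_dv.
Qed.

Lemma proper_divisor_mul3 s t u d :
  prime s -> prime t -> prime u -> proper_divisor (s * t * u)%N d ->
  exists s' t' u', [/\ prime s', prime t', prime u', (s * t * u = s' * t' * u')%N
                     & d = s' \/ d = (s' * t')%N].
Proof.
move=> pr_s pr_t pr_u /and3P[d_dv d_neq1 d_neqn].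
have [/dvdnP[e def_d] | not_sd] := boolP (s %| d).
  rewrite def_d -mulnA mulnC dvdn_pmul2l ?prime_gt0 // in d_dv.
  have [e1 | e_neq1] := eqVneq e 1%N.
    by exists s, t, u; split=> //; left; rewrite def_d e1 mul1n.
  have [def_e | def_e] : e = t \/ e = u.
  - apply: proper_divisor_mul2 => //; rewrite /proper_divisor d_dv e_neq1 /=.
    by apply: contraNneq d_neqn => e_tu; rewrite def_d e_tu mulnC mulnA.
  - by exists s, t, u; split=> //; right; rewrite def_d def_e mulnC.
  by exists s, u, t; split; rewrite // 1?mulnAC //; right; rewrite def_d def_e mulnC.
have {}d_dv : d %| t * u.
  by rewrite -mulnA Gauss_dvdr // coprime_sym prime_coprime in d_dv.
have def_n : (s * t * u = t * u * s)%N by rewrite -mulnA mulnC.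
have [d_tu | d_neq_tu] := eqVneq d (t * u)%N.
  by exists t, u, s; split=> //; right.
have [->|->] : d = t \/ d = u.
- by apply: proper_divisor_mul2; rewrite // /proper_divisor d_dv d_neq1.
- by exists t, u, s; split=> //; left.
by exists u, t, s; split=> //; [rewrite def_n (mulnC u) | left].
Qed.

Section FewSubgroups.

Variables (gT : finGroupType) (G : {group gT}).
Implicit Types (A B C H : {group gT}).

Lemma card_vertexP H :
  nontrivial_proper G H -> H \subset G /\ proper_divisor #|G| #|H|.
Proof. by move=> vH; have /andP[_ /proper_sub sHG] := vH; rewrite -card_vertex. Qed.

Lemma vertex_dvd_mul2 p q H :
  prime p -> prime q -> #|G| %| (p * q)%N -> nontrivial_proper G H -> prime #|H|.
Proof.
move=> pr_p pr_q oG /card_vertexP[_ /and3P[dH neH1 neHG]].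
suffices: #|H| = p \/ #|H| = q by case=> ->.
apply: proper_divisor_mul2 => //; rewrite /proper_divisor neH1 (dvdn_trans dH) //=.
by apply: contra neHG => /eqP oH; rewrite eqn_dvd dH oH.
Qed.

(** All vertices have prime order, so there is no edge. *)
Lemma no_claw_mul2 p q : prime p -> prime q -> #|G| %| (p * q)%N -> no_claw G.
Proof.
move=> pr_p pr_q oG H A _ _ /= /and3P[vH vA _] _ /andP[cHA _].
have no_edge B C :
    nontrivial_proper G B -> nontrivial_proper G C -> B \proper C -> False.
  move=> vB vC sBC; have prC := vertex_dvd_mul2 pr_p pr_q oG vC.
  have prB := vertex_dvd_mul2 pr_p pr_q oG vB.
  have := cardSg (proper_sub sBC); rewrite dvdn_prime2 // => /eqP oBC.
  by have := proper_card sBC; rewrite oBC ltnn.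
by case/orP: cHA; exact: no_edge.
Qed.

Hypothesis cycG : cyclic G.

Lemma cyclic_uniq_card (s : seq {group gT}) :
  {in s, forall H, H \subset G} -> uniq s -> uniq [seq #|(H : {group gT})| | H <- s].
Proof.
move=> sG; rewrite map_inj_in_uniq // => A B /sG sA /sG sB /eqP.
by rewrite -(eq_subG_cyclic cycG) // => /eqP/val_inj.
Qed.

Lemma cyclic_few_orders (s : seq {group gT}) (orders : seq nat) :
  all (nontrivial_proper G) s -> uniq s ->
  {in s, forall H, #|H| \in orders} -> size s <= size orders.
Proof.
move=> /allP vs uniq_s sub_s; rewrite -(size_map (fun H => #|H|)).
apply: uniq_leq_size; last by move=> _ /mapP[H sH ->]; exact: sub_s.
by apply: cyclic_uniq_card => // H /vs/card_vertexP[].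
Qed.

(** The centre of a claw has order s or s * t, where #|G| = s * t * u with s, t, u
    prime.  In the first case the orders of the leaves are among s * t and s * u, in the
    second among s and t; but a subgroup of a cyclic group is determined by its
    order. *)
Lemma no_claw_cyclic_mul3 p q r :
  prime p -> prime q -> prime r -> #|G| = (p * q * r)%N -> no_claw G.
Proof.
move=> pr_p pr_q pr_r oG H A B C vHABC uniqABC cABC.
have [vH vABC] : nontrivial_proper G H /\ all (nontrivial_proper G) [:: A; B; C].
  exact/andP.
have [sHG dH] := card_vertexP vH; rewrite oG in dH.
have [s [t [u [pr_s pr_t pr_u def_n oH]]]] := proper_divisor_mul3 pr_p pr_q pr_r dH.
rewrite def_n in oG.
have many (orders : seq nat) : size orders = 2 ->
    {in [:: A; B; C], forall X, #|(X : {group gT})| \in orders} -> False.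
  by move=> sz /(cyclic_few_orders vABC uniqABC); rewrite sz.
have leaf X : X \in [:: A; B; C] -> nontrivial_proper G X /\ nested H X.
  by move=> lX; rewrite (allP vABC) ?(allP cABC X).
case: oH => oH.
  apply: (many [:: (s * t)%N; (s * u)%N]) => // X /leaf[vX].
  have [sXG /and3P[dX neX1 neXn]] := card_vertexP vX.
  case/orP=> sHX; last first.
    have := cardSg (proper_sub sHX); rewrite oH => /(prime_nt_dvdP pr_s neX1) oX.
    by have := proper_card sHX; rewrite oX oH ltnn.
  have /dvdnP[e oX] := cardSg (proper_sub sHX).
  rewrite oX oH mulnC in dX neXn *.
  have [-> | ->] : e = t \/ e = u; [|by rewrite !inE eqxx ?orbT..].
  apply: proper_divisor_mul2 => //; apply/and3P; split.
  - by rewrite oG -mulnA dvdn_pmul2l ?prime_gt0 in dX.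
  - apply: contraTneq (proper_card sHX) => e1.
    by rewrite oX oH e1 mul1n ltnn.
  by apply: contraNneq neXn => ->; rewrite oG mulnA.
apply: (many [:: s; t]) => // X /leaf[vX].
have [sXG /and3P[dX neX1 neXn]] := card_vertexP vX.
case/orP=> sHX.
  have /dvdnP[e oX] := cardSg (proper_sub sHX).
  have e_u : e = u.
    apply: (prime_nt_dvdP pr_u).
      by apply: contraTneq (proper_card sHX) => e1; rewrite oX e1 mul1n ltnn.
    by move: dX; rewrite oX oG oH mulnC dvdn_pmul2l // muln_gt0 !prime_gt0.
  by case/eqP: neXn; rewrite oX oG oH e_u mulnC.
have [-> | ->] : #|X| = s \/ #|X| = t; [|by rewrite !inE eqxx ?orbT..].
apply: proper_divisor_mul2; rewrite // /proper_divisor neX1 -oH cardSg ?proper_sub //=.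
by rewrite neq_ltn proper_card.
Qed.

Lemma no_claw_cyclic_exp4 p : prime p -> #|G| = (p ^ 4)%N -> no_claw G.
Proof.
move=> pr_p oG H A B C vHABC uniqABC cABC.
have uniqHABC : uniq [:: H; A; B; C].
  rewrite cons_uniq uniqABC andbT; apply/negP=> /(allP cABC).
  by rewrite /nested properxx.
have := cyclic_few_orders (orders := [:: p; p ^ 2; p ^ 3]%N) vHABC uniqHABC.
case/(_ _)/negP=> // X /(allP vHABC)/card_vertexP[_ /and3P[]].
rewrite oG => /(dvdn_pfactor _ _ pr_p)[k k_le ->].
by case: k k_le => [|[|[|[|[|k]]]]] //; rewrite ?eqxx // !inE eqxx ?orbT.
Qed.

End FewSubgroups.

(** * Identification of the groups in the list *)

Lemma Zp_cyclic n : cyclic (Zp n).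
Proof.
by rewrite /Zp; case: ifP => _; [rewrite Zp_cycle cycle_cyclic | exact: cyclic1].
Qed.

Lemma isog_Zp (gT : finGroupType) (G : {group gT}) n :
  0 < n -> reflect (cyclic G /\ #|G| = n) (G \isog Zp n).
Proof.
move=> n_gt0; apply: (iffP idP) => [isoG | [cycG oG]].
  by rewrite (isog_cyclic isoG) Zp_cyclic (card_isog isoG) card_Zp.
by rewrite isog_cyclic_card // Zp_cyclic card_Zp // oG eqxx.
Qed.

Lemma abelem_Zp_square p : prime p -> p.-abelem (setX (Zp p) (Zp p)).
Proof.
move=> pr_p; have abZ := cyclic_abelian (Zp_cyclic p).
apply/(abelemP pr_p); split.
  apply/centsP=> -[a b] /setXP[Za Zb] [c d] /setXP[Zc Zd].
  by congr (_, _); [exact: (centsP abZ) | exact: (centsP abZ)].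
case=> a b /setXP[Za Zb].
have expg_pair n : (a, b) ^+ n = (a ^+ n, b ^+ n).
  by elim: n => // n IHn; rewrite !expgS IHn.
have expZ c : c \in Zp p -> c ^+ p = 1.
  by move=> Zc; rewrite -[p in c ^+ p](card_Zp (prime_gt0 pr_p)) expg_cardG.
by rewrite expg_pair !expZ.
Qed.

Lemma isog_Zp_square (gT : finGroupType) (G : {group gT}) p :
  prime p -> p.-abelem G -> #|G| = (p ^ 2)%N -> G \isog setX (Zp p) (Zp p).
Proof.
move=> pr_p abelG oG; rewrite (isog_abelem_card _ abelG) abelem_Zp_square //=.
by rewrite cardsX card_Zp ?prime_gt0 // oG mulnn.
Qed.

Lemma prime_other2 p q : exists r, [/\ prime r, p != r & q != r].
Proof.
have [r lt_r pr_r] := prime_above (maxn p q); exists r; split=> //.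
  by rewrite ltn_eqF // (leq_ltn_trans (leq_maxl p q)).
by rewrite ltn_eqF // (leq_ltn_trans (leq_maxr p q)).
Qed.

Lemma prime_other1 p : exists q r, [/\ prime q, prime r, p != q, p != r & q != r].
Proof.
have [q [pr_q neq_pq _]] := prime_other2 p p.
by have [r [pr_r neq_pr neq_qr]] := prime_other2 p q; exists q, r.
Qed.

Theorem theorem2p12 (gT : finGroupType) (G : {group gT})
    (vertices_nonempty : exists H : {group gT}, nontrivial_proper G H) :
  (girth (@inclusion_graph gT G) \in [:: Some 3; Some 6; None]) /\
  (subgraph_free (@complete_bipartite 1 3) (@inclusion_graph gT G) <->
   exists p q r : nat,
     [/\ prime p, prime q & prime r] /\ [/\ p != q, p != r & q != r] /\
     ((exists2 alpha : nat, alpha \in [:: 2; 3; 4] & G \isog Zp (p ^ alpha)%N)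
      \/ (exists2 alpha : nat, alpha \in [:: 1%N; 2] &
            G \isog Zp (p ^ alpha * q)%N)
      \/ G \isog Zp (p * q * r)%N
      \/ G \isog setX (Zp p) (Zp p)
      \/ is_Zq_sdprod_Zp G q p)).
Proof.
have [V vV] := vertices_nonempty.
have /and3P[dV neV1 neVG] : proper_divisor #|G| #|V| by have [] := card_vertexP vV.
have G_gt1 : 1 < #|G|.
  have /andP[/trivgPn[x Vx ntx] sVG] := vV.
  by rewrite cardG_gt1; apply/trivgPn; exists x; rewrite // (subsetP (proper_sub sVG)).
have not_prG : ~~ prime #|G|.
  by apply: contra neVG => prG; rewrite (prime_nt_dvdP prG neV1 dV).
split; first exact: girth_inclusion_graph.
split=> [/claw_freeP freeG | [p [q [r [[pr_p pr_q pr_r] [_ classG]]]]]]; last first.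
  apply/claw_freeP; case: classG => [[alpha] |[[alpha] |[|[]]]].
  - rewrite !inE => /or3P[] /eqP-> /isog_Zp[];
      rewrite ?expn_gt0 ?prime_gt0 // => cycG oG.
    + by apply: (no_claw_mul2 pr_p pr_p); rewrite oG.
    + by apply: (no_claw_cyclic_mul3 cycG pr_p pr_p pr_p); rewrite oG mulnn expnSr.
    exact: (no_claw_cyclic_exp4 cycG pr_p).
  - rewrite !inE => /orP[] /eqP-> /isog_Zp[];
      rewrite ?muln_gt0 ?expn_gt0 ?prime_gt0 // => cycG oG.
    + by apply: (no_claw_mul2 pr_p pr_q); rewrite oG expn1.
    by apply: (no_claw_cyclic_mul3 cycG pr_p pr_p pr_q); rewrite oG mulnn.
  - case/isog_Zp; rewrite ?muln_gt0 ?prime_gt0 // => cycG oG.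
    exact: (no_claw_cyclic_mul3 cycG pr_p pr_q pr_r).
  - move/card_isog; rewrite cardsX card_Zp ?prime_gt0 // => oG.
    by apply: (no_claw_mul2 pr_p pr_p); rewrite oG.
  by move/is_Zq_sdprod_Zp_dvd; apply: no_claw_mul2.
have [cycG | not_cycG] := boolP (cyclic G).
  have := no_divisor_claw_order G_gt1 not_prG (no_claw_no_divisor_claw cycG freeG).
  have isoZ n : #|G| = n -> G \isog Zp n.
    by move=> oG; apply/isog_Zp; rewrite -?oG.
  case=> [[p [a [pr_p a_in oG]]] | [p [q [a [pr_p pr_q neq_pq a_in oG]]]]
    | [p [q [r [pr_p pr_q pr_r neqs oG]]]]].
  - have [q [r [pr_q pr_r neq_pq neq_pr neq_qr]]] := prime_other1 p.
    by exists p, q, r; do 2![split=> //]; left; exists a; rewrite // isoZ.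
  - have [r [pr_r neq_pr neq_qr]] := prime_other2 p q.
    by exists p, q, r; do 2![split=> //]; right; left; exists a; rewrite // isoZ.
  by exists p, q, r; do 2![split=> //]; do 2!right; left; apply: isoZ.
pose p := pdiv #|G|; have pr_p : prime p := pdiv_prime G_gt1.
have [pG | not_pG] := boolP (p.-group G).
  have [abelG oG] := no_claw_pgroup freeG pG not_cycG.
  have [q [r [pr_q pr_r neq_pq neq_pr neq_qr]]] := prime_other1 p.
  exists p, q, r; do 2![split=> //]; do 3!right; left; exact: isog_Zp_square.
have [P sylP] := Sylow_exists p G; have sPG := pHall_sub sylP.
have pP : p.-group P := pHall_pgroup sylP.
have ntP : P :!=: 1.
  rewrite -rank_gt0 (rank_Sylow sylP) p_rank_gt0 mem_primes pr_p cardG_gt0.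
  exact: pdiv_dvd.
have prP : P \proper G.
  by rewrite properEneq sPG andbT; apply: contraNneq not_pG => <-.
have cycP := no_claw_cyclic freeG prP.
have [N defG] := central_Sylow_complement sylP (norm_cyclic_Sylow_pdiv sylP cycP).
have [nNG _ mulNP nNP tiNP] := sdprod_context defG.
have ntN : N :!=: 1.
  by apply: contraTneq prP => N1; rewrite -mulNP N1 mul1g properxx.
have prN : N \proper G.
  rewrite properEneq normal_sub // andbT; apply: contraNneq ntP => defN.
  by rewrite -tiNP defN (setIidPr sPG).
have cycN := no_claw_cyclic freeG prN.
have p'N : p^'.-group N.
  by case/and3P: sylP => _ _; rewrite -divgS // -(sdprod_card defG) mulnK ?cardG_gt0.
have p_ndvN : ~~ (p %| #|N|) by rewrite -p'natE.
have oddN : odd #|N|.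
  apply: contraR p_ndvN; rewrite -dvdn2 => N2; suffices -> : p = 2 by [].
  apply/eqP; rewrite eqn_leq prime_gt1 // andbT pdiv_min_dvd //.
  by rewrite (dvdn_trans N2) // cardSg ?normal_sub.
have nnP : ~~ (P <| G).
  apply: contra not_cycG => nPG; have cNP : P \subset 'C(N).
    apply/commG1P; rewrite commGC; apply/trivgP; rewrite -tiNP; apply: commg_subI.
      by rewrite subsetI subxx (subset_trans (normal_sub nNG)) ?normal_norm.
    by rewrite subsetI subxx.
  have defGd : N \x P = G by rewrite dprodE.
  by rewrite (cyclic_dprod defGd) // coprime_sym (pnat_coprime pP).
have prcN := no_claw_prime_kernel freeG defG oddN cycN ntP ntN nnP.
have prcP :=
  no_claw_prime_complement freeG defG oddN (cyclic_abelian cycP) ntP ntN nnP.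
have oP : #|P| = p by apply/eqP; move: pP; rewrite pgroupE pnatE.
have neq_pq : p != #|N| by apply: contraNneq p_ndvN => <-.
have [r [pr_r neq_pr neq_qr]] := prime_other2 p #|N|.
exists p, #|N|, r; do 2![split=> //]; do 4!right; rewrite -oP.
exact: sdprod_prime_is_Zq_sdprod_Zp.
Qed.
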